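(* For $y\in[0,\frac23]$ let $N^{loc}(y)$ denote the number (a nonnegative integer or $+\infty$) of distinct local level sets contained in the level set $L(y)$ of the Takagi function. With respect to uniform (Lebesgue) measure on $[0,\frac23]$, for a full measure set of points $y$ the number $N^{loc}(y)$ is finite. Furthermore, the expected number of local level sets on a level $y$ drawn uniformly from $[0,\frac23]$ is $$\frac32\int_0^{2/3}N^{loc}(y)\,dy=\frac32.$$
   Context: The Takagi function is $\tau(x)=\sum_{n=0}^\infty 2^{-n}\operatorname{dist}(2^n x,\mathbb{Z})$ for $x\in[0,1]$, where $\operatorname{dist}(t,\mathbb{Z})=\inf_{m\in\mathbb{Z}}|t-m|$; its values lie in $[0,\frac23]$. Convention: in level sets and local level sets, an element $x$ specifies a binary expansion $x=0.b_1b_2b_3\ldots=\sum_{j\ge1} b_j2^{-j}$ with $b_j\in\{0,1\}$; a dyadic rational in $(0,1)$ occurs twice, labelled by its two binary expansions (treated as distinct elements). For $0\le y\le \frac23$, the level set is $L(y)=\{x\in[0,1]:\tau(x)=y\}$ (where each element $x$ specifies a binary expansion, so that a dyadic rational in $(0,1)$ with $\tau(x)=y$ occurs twice, as two distinct elements labelled by its two binary expansions). For a binary expansion $x=0.b_1b_2\ldots$ put $D_0(x)=0$ and $D_j(x)=j-2(b_1+\cdots+b_j)$ for $j\ge1$. The balance-set is $Z(x)=\{j\ge 0: D_j(x)=0\}=\{c_0<c_1<c_2<\cdots\}$ with $c_0=0$; if $Z(x)$ is finite with last element $c_n$, set $c_{n+1}=+\infty$. The $k$-th block $B_k(x)$ is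 the indexed string of digits $(b_j)_{c_k<j\le c_{k+1}}$ (all $j>c_k$ if $c_{k+1}=+\infty$). Two expansions are equivalent, $x\sim x'$, if $Z(x)=Z(x')$ and for each $k$ the block $B_k(x')$ either equals $B_k(x)$ or is obtained from it by flipping every digit ($b_j\mapsto 1-b_j$ for all $j$ in the block). The local level set of $x$ is $L_x^{loc}=\{x': x'\sim x\}$. Each level set is a disjoint union of local level sets. *)

(* Defs.v *)
From mathcomp Require Import all_boot all_order all_algebra.
From mathcomp Require Import all_classical all_reals all_analysis.
From mathcomp Require Import measurable_realfun.

Set Implicit Arguments.
Unset Strict Implicit.
Unset Printing Implicit Defensive.

Import Order.TTheory GRing.Theory Num.Theory.
Import numFieldNormedType.Exports.

Local Open Scope classical_set_scope.
Local Open Scope ring_scope.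

Definition dist_int {R : realType} (t : R) : R :=
  inf [set `|t - m%:~R| | m in [set: int]].

Definition takagi {R : realType} (x : R) : R :=
  limn (series (fun n => 2 ^- n * dist_int (2 ^+ n * x) : R)).

(* The expansion 0.b_1 b_2 b_3 ... is encoded by the digit sequence b with
   b j standing for b_{j+1}. The two expansions of a dyadic rational in (0,1)
   are thus two distinct elements of this type, while 0 and 1 have only one. *)
Definition expansion := nat -> bool.

Definition expansion_val (R : realType) (b : expansion) : R :=
  limn (series (fun j => (b j)%:R * 2 ^- j.+1 : R)).

Definition level_set {R : realType} (y : R) : set expansion :=
  [set b | takagi (expansion_val R b) = y].

Definition digit_excess (b : expansion) (j : nat) : int :=
  j%:Z - 2 * (\sum_(i < j) b i)%N%:Z.

Definition balance_set (b : expansion) : set nat :=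
  [set j | digit_excess b j = 0].

(* For c = c_k in the balance set, the positions of the digits b_{j+1} with
   c_k < j + 1 <= c_{k+1}; there is no upper bound when c_{k+1} = +oo. *)
Definition block_positions (b : expansion) (c : nat) : set nat :=
  [set j | (c <= j)%N /\
           forall c', balance_set b c' -> (c < c')%N -> (j < c')%N].

Definition equiv_expansion (b b' : expansion) : Prop :=
  balance_set b = balance_set b' /\
  forall c, balance_set b c ->
    (forall j, block_positions b c j -> b' j = b j) \/
    (forall j, block_positions b c j -> b' j = ~~ b j).

Definition local_level_set (b : expansion) : set expansion :=
  [set b' | equiv_expansion b b'].

Definition local_level_sets_in {R : realType} (y : R) : set (set expansion) :=
  [set A | (exists b, A = local_level_set b) /\ A `<=` level_set y].

Definition Nloc {R : realType} (y : R) : \bar R :=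
  counting (local_level_sets_in y).

(* Main.v *)
Require Import Defs.
From mathcomp Require Import all_boot all_order all_algebra.
From mathcomp Require Import all_classical all_reals all_analysis.
From mathcomp Require Import measurable_realfun.
From mathcomp Require Import zify ring lra.

Import Order.TTheory GRing.Theory Num.Theory.
Import numFieldNormedType.Exports.

Local Open Scope classical_set_scope.
Local Open Scope ring_scope.

(** The expected number of local level sets comes from a random walk. Fix
    digits b_1, ..., b_n with excess d = D_n. By the functional equation of the
    Takagi function, appending the expansion of x to them produces the value
    a + 2^-n (tau(x) + d x), where a depends only on the digits.

    A local level set consists of the expansions b' with |D_j(b')| = |D_j(b)|
    for all j ([equiv_expansionP]). It therefore has exactly one member whose
    excess is never negative, and tau is constant on it
    ([centered_takagi_abs]). Hence Nloc y counts the expansions b with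
    D_j(b) >= 0 for all j and tau(b) = y ([local_level_sets_inE]).

    Allow the expansions whose excess never goes below -d. On them the values
    of tau(x) + d x fill the interval [0, M_d] with M_d = d + (2/3) 2^-d
    ([tilted_takagi_image]). A nonnegative digit path of length n that ends at
    height d can thus be continued to a solution of tau(b) = y exactly when y
    lies in one interval of length 2^-n M_d. Let N_n(y) be the number of paths
    of length n that can be continued. Distinct solutions are separated by
    long enough prefixes, so N_n(y) increases to Nloc y ([Nloc_limn]), and by
    monotone convergence the integral of Nloc is the limit of
      2^-n (sum of M_d over the nonnegative paths of length n)
        = E(M_(S_n) ; S_1, ..., S_n >= 0),
    where S is the simple random walk from 0.

    The function d + 1 is harmonic for the walk killed at -1, and M_d lies
    between d and d + 1. The expectation above therefore differs from 1 by at
    most the probability of surviving n steps ([iter_killed_tilt_max]), which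
    tends to 0 ([cvg_survival]). So the integral of Nloc is 1. This gives the
    expectation 3/2, and Nloc, being integrable, is finite almost
    everywhere. *)

(** * Digits and the walk of the excess *)

Definition digit_step (c : bool) : int := if c then -1 else 1.

Definition shift_expansion (b : expansion) : expansion := fun j => b j.+1.

Definition cons_expansion (c : bool) (b : expansion) : expansion :=
  fun j => if j is j'.+1 then b j' else c.

Lemma digit_excess0 (b : expansion) : digit_excess b 0 = 0.
Proof. by rewrite /digit_excess big_ord0. Qed.

Lemma digit_excessS (b : expansion) (j : nat) :
  digit_excess b j.+1 = digit_excess b j + digit_step (b j).
Proof.
rewrite /digit_excess /digit_step big_ord_recr /=.
by move: (\sum_(i < j) b i)%N => s; case: (b j); rewrite ?addn1 ?addn0; lia.
Qed.

Lemma digit_excess_shift (b : expansion) (j : nat) :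
  digit_excess b j.+1 = digit_step (b 0) + digit_excess (shift_expansion b) j.
Proof.
elim: j => [|j IH]; first by rewrite digit_excessS !digit_excess0 add0r addr0.
by rewrite digit_excessS IH [X in _ = _ + X]digit_excessS -addrA.
Qed.

(** * Functional equations of the Takagi function *)

Lemma dist_int_has_inf {R : realType} (t : R) :
  has_inf [set `|t - m%:~R| | m in [set: int]].
Proof.
split; first by exists `|t - 0%:~R|, 0.
by exists 0 => _ [m _ <-].
Qed.

Lemma dist_int_addz {R : realType} (t : R) (k : int) :
  dist_int (t + k%:~R) = dist_int t.
Proof.
rewrite /dist_int; congr inf; apply/seteqP; split => _ [m _ <-].
  exists (m - k) => //; congr (`| _ |); rewrite intrB; ring.
exists (m + k) => //; congr (`| _ |); rewrite intrD; ring.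
Qed.

Lemma dist_int_ge0 {R : realType} (t : R) : 0 <= dist_int t.
Proof.
apply: lb_le_inf; first by case: (dist_int_has_inf t).
by move=> _ [m _ <-].
Qed.

Lemma dist_int_small {R : realType} (t : R) : `|t| <= 2^-1 -> dist_int t = `|t|.
Proof.
move=> t2; apply/eqP; rewrite eq_le; apply/andP; split.
  by apply: ge_inf; [case: (dist_int_has_inf t)|exists 0; rewrite ?subr0].
apply: lb_le_inf; first by case: (dist_int_has_inf t).
move=> _ [m _ <-]; have [->|m0] := eqVneq m 0; first by rewrite subr0.
have : 1 <= `|m%:~R : R| by rewrite -intr_norm ler1z; lia.
have := ler_normD (m%:~R - t) t; rewrite subrK distrC.
by lra.
Qed.

Lemma dist_int_le1 {R : realType} (t : R) : dist_int t <= 1.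
Proof.
have /andP[h1 h2] := floor_itv t.
apply: (@le_trans _ _ `|t - (Num.floor t)%:~R|).
  by apply: ge_inf; [case: (dist_int_has_inf t)|exists (Num.floor t)].
rewrite ger0_norm ?subr_ge0//; move: h2; rewrite intrD => h2; lra.
Qed.

Definition takagi_term {R : realType} (x : R) : R^nat :=
  fun n => 2 ^- n * dist_int (2 ^+ n * x).

Lemma is_cvg_geometric_half {R : realType} :
  cvgn (series (fun n => 2 ^- n : R)).
Proof.
have -> : (fun n => 2 ^- n : R) = geometric 1 2^-1.
  by apply/funext => n /=; rewrite mul1r exprVn.
by apply: is_cvg_geometric_series; rewrite ger0_norm ?invf_lt1//; lra.
Qed.

Lemma limn_geometric_half {R : realType} :
  limn (series (fun n => 2 ^- n : R)) = 2.
Proof.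
have -> : (fun n => 2 ^- n : R) = geometric 1 2^-1.
  by apply/funext => n /=; rewrite mul1r exprVn.
have h : `|2^-1 : R| < 1 by rewrite ger0_norm ?invf_lt1//; lra.
rewrite (cvg_lim _ (@cvg_geometric_series R 1 _ h))//; by field.
Qed.

Lemma takagi_term_ge0 {R : realType} (x : R) n : 0 <= takagi_term x n.
Proof. by rewrite mulr_ge0 ?dist_int_ge0// invr_ge0 exprn_ge0. Qed.

Lemma takagi_term_le {R : realType} (x : R) n : takagi_term x n <= 2 ^- n.
Proof. by rewrite ler_piMr ?dist_int_le1// invr_ge0 exprn_ge0. Qed.

Lemma is_cvg_takagi {R : realType} (x : R) : cvgn (series (takagi_term x)).
Proof.
apply: (series_le_cvg (takagi_term_ge0 x) _ (takagi_term_le x)).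
  by move=> n; rewrite invr_ge0 exprn_ge0.
exact: is_cvg_geometric_half.
Qed.

Lemma takagi_bounds {R : realType} (x : R) : 0 <= takagi x <= 2.
Proof.
apply/andP; split.
  apply: limr_ge; first exact: is_cvg_takagi.
  by apply: nearW => n; apply: sumr_ge0 => i _; exact: takagi_term_ge0.
rewrite -(@limn_geometric_half R); apply: ler_lim; first exact: is_cvg_takagi.
  exact: is_cvg_geometric_half.
by apply: nearW => n; apply: ler_sum => i _; exact: takagi_term_le.
Qed.

(** Both series in play, for the Takagi function and for the value of an
    expansion, have a tail that is half of a series of the same kind. *)
Lemma limn_seriesS {R : realType} (u v : R^nat) :
  cvgn (series v) -> (forall n, u n.+1 = 2^-1 * v n) ->
  limn (series u) = u 0%N + 2^-1 * limn (series v).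
Proof.
move=> cv uv; apply: cvg_lim => //.
rewrite -(cvg_shiftS (series u)).
have -> : (fun n => series u n.+1) = (fun n => u 0%N + 2^-1 * series v n).
  apply/funext => n; rewrite /series /= big_nat_recl// mulr_sumr.
  by congr (_ + _); apply: eq_bigr => i _; rewrite uv.
by apply: cvgD; [exact: cvg_cst|apply: cvgM cv; exact: cvg_cst].
Qed.

Lemma takagi_addz {R : realType} (x : R) (k : int) :
  takagi (x + k%:~R) = takagi x.
Proof.
rewrite /takagi; congr (limn (series _)); apply/funext => n.
congr (_ * _); rewrite mulrDr.
have -> : 2 ^+ n * k%:~R = (2 ^+ n * k)%:~R :> R by rewrite intrM rmorphXn.
exact: dist_int_addz.
Qed.

Lemma takagi_double {R : realType} (x : R) :
  takagi x = dist_int x + 2^-1 * takagi (2 * x).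
Proof.
rewrite [LHS](@limn_seriesS _ _ (takagi_term (2 * x))).
- by rewrite expr0 invr1 !mul1r.
- exact: is_cvg_takagi.
- by move=> n; rewrite /takagi_term exprS invfM !mulrA [2^+n*2]mulrC.
Qed.

(** On each half of the unit interval the first term of the series is affine,
    so the functional equation expresses tau there by tau on [0, 1]; the two
    halves correspond to the two values of the first digit. *)
Lemma takagi_half0 {R : realType} (x : R) : 0 <= x <= 1 ->
  takagi (2^-1 * x) = 2^-1 * (x + takagi x).
Proof.
move=> x01; rewrite takagi_double mulrA divff// mul1r [RHS]mulrDr.
congr (_ + _).
rewrite dist_int_small ger0_norm//; lra.
Qed.

Lemma takagi_half1 {R : realType} (x : R) : 0 <= x <= 1 ->
  takagi (2^-1 * (1 + x)) = 2^-1 * (1 - x + takagi x).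
Proof.
move=> x01; rewrite takagi_double mulrA divff// mul1r [RHS]mulrDr.
congr (_ + _).
  rewrite -(@dist_int_addz _ _ (-1)) dist_int_small ler0_norm; lra.
by rewrite addrC (@takagi_addz _ _ 1).
Qed.

Lemma is_cvg_expansion {R : realType} (b : expansion) :
  cvgn (series (fun j => (b j)%:R * 2 ^- j.+1 : R)).
Proof.
apply: (@series_le_cvg _ _ (fun n => 2 ^- n)).
- by move=> n; rewrite mulr_ge0// invr_ge0 exprn_ge0.
- by move=> n; rewrite invr_ge0 exprn_ge0.
- move=> n; apply: (@le_trans _ _ (2 ^- n.+1)).
    by rewrite ler_piMl// ?invr_ge0 ?exprn_ge0//; case: (b n).
  by rewrite lef_pV2 ?posrE ?exprn_gt0// ler_eXn2l// ltr1n.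
- exact: is_cvg_geometric_half.
Qed.

Lemma expansion_valE {R : realType} (b : expansion) :
  expansion_val R b = 2^-1 * ((b 0%N)%:R + expansion_val R (shift_expansion b)).
Proof.
rewrite [LHS](@limn_seriesS _ _
  (fun j => (shift_expansion b j)%:R * 2 ^- j.+1)).
- by rewrite mulrDr expr1 mulrC.
- exact: is_cvg_expansion.
- by move=> n; rewrite exprS invfM mulrCA.
Qed.

Lemma expansion_val_bounds {R : realType} (b : expansion) :
  0 <= expansion_val R b <= 1.
Proof.
apply/andP; split.
  apply: limr_ge; first exact: is_cvg_expansion.
  by apply: nearW => n; apply: sumr_ge0 => i _;
    rewrite mulr_ge0// invr_ge0 exprn_ge0.
have -> : 1 = limn (series (fun n => 2^-1 * 2 ^- n : R)).
  rewrite -[LHS](@divff _ 2)// -{1}(@limn_geometric_half R) mulrC.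
  apply/esym/cvg_lim => //.
  have -> : series (fun n => 2^-1 * 2 ^- n : R) =
            (fun n => 2^-1 * series (fun n => 2 ^- n : R) n).
    by apply/funext => n; rewrite /series /= mulr_sumr.
  by apply: cvgM is_cvg_geometric_half; exact: cvg_cst.
apply: ler_lim; first exact: is_cvg_expansion.
  rewrite -[X in cvgn (series X)]/(2^-1 \*: (fun n => 2 ^- n : R)).
  exact: is_cvg_seriesZ is_cvg_geometric_half.
apply: nearW => n; apply: ler_sum => i _.
rewrite exprS invfM ler_piMl//; last by case: (b i).
Qed.

(** * Tilted Takagi functions *)

Lemma le0_of_le_geometric {R : realType} (x c : R) :
  (forall n, x <= c * (3 / 4) ^+ n) -> x <= 0.
Proof.
move=> xc; have h : `|3 / 4 : R| < 1 by rewrite ger0_norm; lra.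
have ch := @cvg_geometric R c _ h.
rewrite -(cvg_lim _ ch)//; apply: limr_ge; first exact: cvgP ch.
by apply: nearW => n; exact: xc.
Qed.

(** Several statements below compare two quantities indexed by an integer d,
    where one digit halves the discrepancy but may increase |d| by 1. An error
    of 2 (|d| + 2) (3/4)^n absorbs both effects: as 2 (m + 3) <= 3 (m + 2),
    the halved error at m + 1 is at most 3/4 of the error at m. *)
Lemma geometric_step {R : realType} (k m r : R) :
  0 <= m -> k <= m + 1 -> 0 <= r ->
  2^-1 * (2 * (k + 2) * r) <= 2 * (m + 2) * (3 / 4 * r).
Proof.
move=> m0 km r0; rewrite [leRHS]mulrA [leLHS]mulrA.
by apply: ler_wpM2r => //; lra.
Qed.

(** Up to an affine map, the values of tau on the expansions that begin with
    given digits of excess d are the values of tau(x) + d x. *)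
Definition tilted_takagi (R : realType) (d : int) (b : expansion) : R :=
  takagi (expansion_val R b) + d%:~R * expansion_val R b.

Lemma tilted_takagiE {R : realType} (d : int) (b : expansion) :
  tilted_takagi R d b =
  2^-1 * (tilted_takagi R (d + digit_step (b 0%N)) (shift_expansion b) +
          (if b 0%N then d + 1 else 0)%:~R).
Proof.
have v01 := @expansion_val_bounds R (shift_expansion b).
rewrite /tilted_takagi expansion_valE /digit_step; case: (b 0%N);
  rewrite ?mulr1n ?mulr0n.
  by rewrite takagi_half1// !intrD mulrN1z; field.
by rewrite add0r takagi_half0// intrD; field.
Qed.

(** The tilted function minus its slope's contribution at x = 1/2. With this
    normalization flipping all digits and negating d leaves the value
    unchanged. *)
Definition centered_takagi (R : realType) (d : int) (b : expansion) : R :=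
  tilted_takagi R d b - d%:~R / 2.

Lemma centered_takagiE {R : realType} (d : int) (b : expansion) :
  centered_takagi R d b =
  2^-1 * centered_takagi R (d + digit_step (b 0%N)) (shift_expansion b) +
  (1 - digit_step (b 0%N) * d)%:~R / 4.
Proof.
rewrite /centered_takagi tilted_takagiE /digit_step.
by case: (b 0%N); rewrite !(intrD, mulrNz, intrM); field.
Qed.

Lemma centered_takagi_le {R : realType} (d : int) (b : expansion) :
  `|centered_takagi R d b| <= `|d|%:~R + 2.
Proof.
have /andP[v0 v1] := @expansion_val_bounds R b.
have /andP[t0 t2] := takagi_bounds (expansion_val R b).
rewrite /centered_takagi /tilted_takagi -addrA addrC.
apply: le_trans (ler_normD _ _) _; apply: lerD; last by rewrite ger0_norm.
rewrite -mulrBr normrM -intr_norm ler_piMr//.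
by rewrite ler_norml; apply/andP; split; lra.
Qed.

(** In the one-digit recursion, d only enters the constant term through the
    product of d with the first step e, and 2 e d = |d + e|^2 - |d|^2 - 1 is
    determined by absolute values. The two sides therefore satisfy the same
    recursion, and halving at each digit forces them to agree. *)
Lemma centered_takagi_abs {R : realType} (d d' : int) (b b' : expansion) :
  (forall j, `|d + digit_excess b j| = `|d' + digit_excess b' j|) ->
  centered_takagi R d b = centered_takagi R d' b'.
Proof.
move=> bb'; apply/eqP; rewrite -subr_eq0 -normr_le0; apply/eqP.
suff step n : `|centered_takagi R d b - centered_takagi R d' b'| <=
              2 * (`|d|%:~R + 2) * (3 / 4) ^+ n.
  by apply/eqP; apply: le0_of_le_geometric step.
elim: n d d' b b' bb' => [|n IH] d d' b b' bb'.
  have := bb' 0%N; rewrite !digit_excess0 !addr0 => dd'.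
  rewrite expr0 mulr1 mulr2n mulrDl mul1r.
  apply: le_trans (ler_normB _ _) _; apply: lerD.
    exact: centered_takagi_le.
  by rewrite dd'; exact: centered_takagi_le.
have h0 := bb' 0%N; have h1 := bb' 1%N.
move: h0 h1; rewrite !digit_excessS !digit_excess0 !addr0 !add0r => h0 h1.
have e : digit_step (b 0%N) * d = digit_step (b' 0%N) * d'.
  by move: h0 h1; rewrite /digit_step; case: (b 0%N); case: (b' 0%N); lia.
rewrite centered_takagiE [in X in _ - X]centered_takagiE e.
rewrite opprD addrACA subrr addr0 -mulrBr normrM ger0_norm// exprS.
have {}IH := IH (d + digit_step (b 0%N)) (d' + digit_step (b' 0%N))
  (shift_expansion b) (shift_expansion b') _.
apply: le_trans (ler_wpM2l _ (IH _)) _; first by rewrite invr_ge0.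
  by move=> j; rewrite -!addrA -!digit_excess_shift; exact: bb'.
apply: geometric_step; rewrite ?exprn_ge0//.
rewrite -[1]/(1%:~R) -intrD ler_int /digit_step; case: (b 0%N); lia.
Qed.

(** * The interval of values on nonnegative paths *)

(** The walk that starts at height d and moves by the digit steps never becomes
    negative. *)
Definition stays_above (d : nat) (b : expansion) : Prop :=
  forall j, 0 <= d%:Z + digit_excess b j.

Lemma stays_above_shift0 (d : nat) (b : expansion) : b 0%N = false ->
  stays_above d b -> stays_above d.+1 (shift_expansion b).
Proof.
move=> b0 db j; have := db j.+1.
by rewrite digit_excess_shift b0 /digit_step /=; lia.
Qed.

Lemma stays_above_shift1 (d : nat) (b : expansion) : b 0%N = true ->
  stays_above d b -> (0 < d)%N /\ stays_above d.-1 (shift_expansion b).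
Proof.
move=> b0 db; have d0 : (0 < d)%N.
  by have := db 1%N; rewrite digit_excessS digit_excess0 b0 /digit_step; lia.
split=> // j; have := db j.+1.
by rewrite digit_excess_shift b0 /digit_step /=; lia.
Qed.

Lemma shift_cons (c : bool) (b : expansion) :
  shift_expansion (cons_expansion c b) = b.
Proof. by []. Qed.

Lemma stays_above_cons0 (d : nat) (b : expansion) :
  stays_above d.+1 b -> stays_above d (cons_expansion false b).
Proof.
move=> db [|j]; first by rewrite digit_excess0 addr0.
by have := db j; rewrite digit_excess_shift shift_cons /digit_step /=; lia.
Qed.

Lemma stays_above_cons1 (d : nat) (b : expansion) :
  stays_above d b -> stays_above d.+1 (cons_expansion true b).
Proof.
move=> db [|j]; first by rewrite digit_excess0 addr0.
by have := db j; rewrite digit_excess_shift shift_cons /digit_step /=; lia.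
Qed.

Lemma tilted_takagi0 {R : realType} (d : nat) (b : expansion) : b 0%N = false ->
  tilted_takagi R d b = 2^-1 * tilted_takagi R d.+1 (shift_expansion b).
Proof. by move=> b0; rewrite tilted_takagiE b0 addr0 intS [1 + _]addrC. Qed.

Lemma tilted_takagi1 {R : realType} (d : nat) (b : expansion) : b 0%N = true ->
  tilted_takagi R d.+1 b =
  2^-1 * (tilted_takagi R d (shift_expansion b) + d.+2%:R).
Proof.
move=> b0; rewrite tilted_takagiE b0; congr (_ * (tilted_takagi _ _ _ + _)).
  by rewrite /digit_step; lia.
by rewrite addrC -intS.
Qed.

Lemma tilted_takagi_bounds {R : realType} (d : nat) (b : expansion) :
  0 <= tilted_takagi R d b <= d%:R + 2.
Proof.
have /andP[v0 v1] := @expansion_val_bounds R b.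
have /andP[t0 t2] := takagi_bounds (expansion_val R b).
rewrite /tilted_takagi -pmulrn addr_ge0 ?mulr_ge0//= addrC.
by apply: lerD => //; rewrite ler_piMr.
Qed.

(** The maximum of tau(x) + d x over the expansions whose excess stays at least
    -d. It is the solution of M_(d+1) = (M_d + d + 2) / 2 with M_0 = 2/3. *)
Definition tilt_max {R : realType} (d : nat) : R := d%:R + 2 / 3 * 2 ^- d.

Lemma tilt_max_ge {R : realType} (d : nat) : d%:R <= tilt_max d :> R.
Proof. by rewrite lerDl mulr_ge0// invr_ge0 exprn_ge0. Qed.

Lemma half_expr_bounds {R : realType} (d : nat) : 0 <= (2 ^- d : R) <= 1.
Proof.
by rewrite invr_ge0 exprn_ge0//= invf_le1 ?exprn_gt0// exprn_ege1// ler1n.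
Qed.

Lemma tilt_max_le {R : realType} (d : nat) : tilt_max d <= d%:R + 1 :> R.
Proof. by have := @half_expr_bounds R d; rewrite /tilt_max; lra. Qed.

(** At height d + 1 the maximum is reached by an expansion with first digit
    1. *)
Lemma tilt_maxS {R : realType} (d : nat) :
  tilt_max d.+1 = 2^-1 * (tilt_max d + d.+2%:R) :> R.
Proof. by rewrite /tilt_max exprS invfM -!natr1; field. Qed.

(** The values with first digit 0 reach M_(d+1) / 2, which cannot exceed M_d;
    the two are equal at d = 0, where 0 is the only digit allowed. *)
Lemma tilt_maxS_le {R : realType} (d : nat) :
  tilt_max d.+1 <= 2 * tilt_max d :> R.
Proof.
case: d => [|d]; first by rewrite /tilt_max expr0 expr1; lra.
have := @half_expr_bounds R d; have := ler0n R d.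
rewrite /tilt_max !exprS !invfM -(natr1 d.+1) -(natr1 d); lra.
Qed.

Lemma tilted_takagi_le_max {R : realType} (d : nat) (b : expansion) :
  stays_above d b -> tilted_takagi R d b <= tilt_max d.
Proof.
move=> db; rewrite -subr_le0.
suff step n : tilted_takagi R d b - tilt_max d <=
              2 * (d%:R + 2) * (3 / 4) ^+ n.
  exact: le0_of_le_geometric _ _ step.
elim: n d b db => [|n IH] d b db.
  have /andP[_] := @tilted_takagi_bounds R d b.
  have := @tilt_max_ge R d; have := ler0n R d; rewrite expr0; lra.
have r0 : 0 <= (3 / 4) ^+ n :> R by rewrite exprn_ge0.
rewrite exprS; case b0: (b 0%N).
  have [d0 db'] := stays_above_shift1 _ _ b0 db.
  case: d d0 db db' => // d _ db db'; have := IH _ _ db'.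
  rewrite (tilted_takagi1 _ _ b0) tilt_maxS => h.
  have k_le : d%:R <= d.+1%:R + 1 :> R by rewrite -natr1; lra.
  have := geometric_step _ _ _ (ler0n R d.+1) k_le r0; lra.
have := IH _ _ (stays_above_shift0 _ _ b0 db).
rewrite (tilted_takagi0 _ _ b0) => h.
have := @tilt_maxS_le R d.
have := geometric_step _ _ _ (ler0n R d) (lexx (d%:R + 1)) r0.
rewrite natr1; lra.
Qed.

(** A state (d, y) asks for an expansion whose excess stays at least -d and on
    which tau(x) + d x takes the value y. The digit 0 is chosen whenever the
    doubled target 2 y is still attainable at height d + 1. *)
Definition greedy_digit {R : realType} (p : nat * R) : bool :=
  tilt_max p.1.+1 < 2 * p.2.

Definition greedy_next {R : realType} (p : nat * R) : nat * R :=
  if greedy_digit p then (p.1.-1, 2 * p.2 - p.1.+1%:R) else (p.1.+1, 2 * p.2).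

Definition greedy_expansion {R : realType} (p : nat * R) : expansion :=
  fun j => greedy_digit (iter j greedy_next p).

Lemma shift_greedy {R : realType} (p : nat * R) :
  shift_expansion (greedy_expansion p) = greedy_expansion (greedy_next p).
Proof. by apply/funext => j; rewrite /shift_expansion /greedy_expansion iterSr. Qed.

Lemma greedy_digit_gt0 {R : realType} (d : nat) (y : R) :
  0 <= y <= tilt_max d -> greedy_digit (d, y) -> (0 < d)%N.
Proof.
case: d => // /andP[_ y1]; rewrite /greedy_digit /= ltNge => /negP[].
by apply: le_trans (_ : 2 * tilt_max 0 <= _); rewrite ?ler_pM2l// /tilt_max
  expr0 expr1; lra.
Qed.

(** If 2 y exceeds M_(d+1), it exceeds d + 1 as well, so the target left after
    the digit 1 is nonnegative: the two intervals of values, for first digit 0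
    and 1, overlap and cover [0, M_d]. *)
Lemma greedy_next_range {R : realType} (p : nat * R) :
  0 <= p.2 <= tilt_max p.1 ->
  0 <= (greedy_next p).2 <= tilt_max (greedy_next p).1.
Proof.
case: p => d y /= y01; rewrite /greedy_next; case: ifPn => g /=; last first.
  by move: g; rewrite /greedy_digit /= -leNgt; lra.
have d0 := greedy_digit_gt0 _ _ y01 g.
move: g y01; rewrite /greedy_digit /=; case: d d0 => // d _ g /=.
rewrite tilt_maxS; have := @tilt_max_ge R d.+2; lra.
Qed.

Lemma greedy_stays_above {R : realType} (p : nat * R) :
  0 <= p.2 <= tilt_max p.1 -> stays_above p.1 (greedy_expansion p).
Proof.
move=> p01 j; elim: j p p01 => [|j IH] p p01.
  by rewrite digit_excess0 addr0.
have := IH _ (greedy_next_range _ p01); rewrite digit_excess_shift shift_greedy.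
case: p p01 => d y p01; have := greedy_digit_gt0 _ _ p01.
have -> : greedy_expansion (d, y) 0%N = greedy_digit (d, y) by [].
rewrite {1}/greedy_next.
by case: (greedy_digit (d, y)) => [/(_ isT)|_]; rewrite /digit_step /=; lia.
Qed.

Lemma tilted_greedy {R : realType} (p : nat * R) :
  0 <= p.2 <= tilt_max p.1 -> tilted_takagi R p.1 (greedy_expansion p) = p.2.
Proof.
move=> p01; apply/eqP; rewrite -subr_eq0 -normr_le0; apply/eqP.
suff step n : `|tilted_takagi R p.1 (greedy_expansion p) - p.2| <=
              2 * (p.1%:R + 2) * (3 / 4) ^+ n.
  by apply/eqP; exact: le0_of_le_geometric _ _ step.
elim: n p p01 => [|n IH] p p01.
  have := @tilted_takagi_bounds R p.1 (greedy_expansion p).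
  have := @tilt_max_le R p.1; have := ler0n R p.1.
  by rewrite expr0 ler_norml => ? ? ?; apply/andP; split; lra.
have r0 : 0 <= (3 / 4) ^+ n :> R by rewrite exprn_ge0.
have := IH _ (greedy_next_range _ p01); rewrite -shift_greedy exprS.
case: p p01 => d y p01; have := greedy_digit_gt0 _ _ p01.
have eb : greedy_expansion (d, y) 0%N = greedy_digit (d, y) by [].
rewrite /greedy_next /=; move: eb.
case: (greedy_digit (d, y)) => [eb /(_ isT)|eb _] /=.
  case: d p01 eb => // d p01 eb _ /=.
  rewrite (tilted_takagi1 _ _ eb) => h.
  have k_le : d%:R <= d.+1%:R + 1 :> R by rewrite -natr1; lra.
  have := geometric_step _ _ _ (ler0n R d.+1) k_le r0.
  by move: h; rewrite !ler_norml => h ?; apply/andP; split; lra.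
rewrite (tilted_takagi0 _ _ eb) => h.
have := geometric_step _ _ _ (ler0n R d) (lexx (d%:R + 1)) r0; rewrite natr1.
by move: h; rewrite !ler_norml => h ?; apply/andP; split; lra.
Qed.

Lemma tilted_takagi_image {R : realType} (d : nat) (y : R) :
  [set tilted_takagi R d b | b in stays_above d] y <-> 0 <= y <= tilt_max d.
Proof.
split=> [[b db <-]|y01].
  have /andP[-> _] := @tilted_takagi_bounds R d b.
  exact: tilted_takagi_le_max.
exists (greedy_expansion (d, y)); first exact: (greedy_stays_above (d, y)).
exact: (tilted_greedy (d, y)).
Qed.

(** * Counting prefixes of solutions *)

(** The solutions in a cylinder: a, s = 2^-n and d record what n digits already
    chosen contribute to the value. *)
Definition tilted_level_set {R : realType} (d : nat) (a s y : R) :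
    set expansion :=
  [set b | stays_above d b /\ a + s * tilted_takagi R d b = y].

(** The number of digit strings of length n that begin a solution. The window
    [a, a + s M_d] of attainable values is carried along the recursion rather
    than rescaling y, so that the integral over y becomes a sum of interval
    lengths. *)
Fixpoint prefix_count {R : realType} (n d : nat) (a s y : R) : nat :=
  if n is n'.+1 then
    (prefix_count n' d.+1 a (s / 2) y +
     if d is d'.+1 then prefix_count n' d' (a + s * (d'.+2%:R / 2)) (s / 2) y
     else 0)%N
  else nat_of_bool (a <= y <= a + s * tilt_max d)%R.

Lemma tilted_level_cons0 {R : realType} (d : nat) (a s y : R) (b : expansion) :
  tilted_level_set d.+1 a (s / 2) y b ->
  tilted_level_set d a s y (cons_expansion false b).
Proof.
case=> db <-; split; first exact: stays_above_cons0.
by rewrite tilted_takagi0// shift_cons; field.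
Qed.

Lemma tilted_level_cons1 {R : realType} (d : nat) (a s y : R) (b : expansion) :
  tilted_level_set d (a + s * (d.+2%:R / 2)) (s / 2) y b ->
  tilted_level_set d.+1 a s y (cons_expansion true b).
Proof.
case=> db <-; split; first exact: stays_above_cons1.
by rewrite tilted_takagi1// shift_cons; field.
Qed.

Lemma tilted_level_shift0 {R : realType} (d : nat) (a s y : R) (b : expansion) :
  b 0%N = false -> tilted_level_set d a s y b ->
  tilted_level_set d.+1 a (s / 2) y (shift_expansion b).
Proof.
move=> b0 [db <-]; split; first exact: stays_above_shift0.
by rewrite (tilted_takagi0 _ _ b0); field.
Qed.

Lemma tilted_level_shift1 {R : realType} (d : nat) (a s y : R) (b : expansion) :
  b 0%N = true -> tilted_level_set d.+1 a s y b ->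
  tilted_level_set d (a + s * (d.+2%:R / 2)) (s / 2) y (shift_expansion b).
Proof.
move=> b0 [db <-]; have [_ db'] := stays_above_shift1 _ _ b0 db; split => //.
by rewrite (tilted_takagi1 _ _ b0); field.
Qed.

Lemma tilted_level_set_neq0 {R : realType} (d : nat) (a s y : R) : 0 < s ->
  a <= y <= a + s * tilt_max d <-> exists b, tilted_level_set d a s y b.
Proof.
move=> s0; split=> [/andP[ay ya]|[b [db <-]]].
  have /(tilted_takagi_image d)[b db Fb] : 0 <= (y - a) / s <= tilt_max d.
    by rewrite divr_ge0 ?subr_ge0 ?(ltW s0)//= ler_pdivrMr// lerBlDl mulrC.
  by exists b; split=> //; rewrite Fb mulrC divfK ?gt_eqF// addrC subrK.
have /andP[F0 _] := @tilted_takagi_bounds R d b.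
rewrite lerDl mulr_ge0 ?(ltW s0)//= lerD2l ler_pM2l//.
exact: tilted_takagi_le_max.
Qed.

Lemma cons_expansion_inj (c : bool) : injective (cons_expansion c).
Proof. by move=> b b' e; rewrite -(shift_cons c b) e. Qed.

Lemma prefix_count_witnesses {R : realType} (n d : nat) (a s y : R) : 0 < s ->
  exists l : seq expansion, [/\ uniq l,
    (forall b, b \in l -> tilted_level_set d a s y b) &
    size l = prefix_count n d a s y].
Proof.
elim: n d a s => [|n IH] d a s s0 /=.
  case y01: (a <= y <= _); last by exists [::].
  have [b yb] := (tilted_level_set_neq0 d a s y s0).1 y01.
  by exists [:: b]; split=> // b'; rewrite inE => /eqP->.
have s20 : 0 < s / 2 by lra.
have [l0 [ul0 yl0 <-]] := IH d.+1 a (s / 2) s20.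
have [l1 [ul1 yl1 <-]] : exists l1 : seq expansion, [/\ uniq l1,
    (forall b, b \in l1 -> tilted_level_set d a s y (cons_expansion true b)) &
    size l1 = if d is d'.+1
              then prefix_count n d' (a + s * (d'.+2%:R / 2)) (s / 2) y else 0%N].
  case: d {l0 ul0 yl0} => [|d]; first by exists [::].
  have [l1 [ul1 yl1 <-]] := IH d (a + s * (d.+2%:R / 2)) (s / 2) s20.
  by exists l1; split=> // b /yl1; exact: tilted_level_cons1.
exists ([seq cons_expansion false b | b <- l0] ++
        [seq cons_expansion true b | b <- l1]); split.
- rewrite cat_uniq !map_inj_uniq ?ul0 ?ul1 ?andbT//=; last 2 first.
    exact: cons_expansion_inj.
    exact: cons_expansion_inj.
  apply/hasPn => _ /mapP[b _ ->]; apply/mapP => -[b' _].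
  by move=> /(congr1 (fun b => b 0%N)).
- move=> b; rewrite mem_cat => /orP[] /mapP[b' lb' ->].
    exact/tilted_level_cons0/yl0.
  exact: yl1.
- by rewrite size_cat !size_map.
Qed.

(** The reverse estimate to [prefix_count_witnesses]: it can only hold for
    solutions told apart by their first n digits. *)
Lemma size_le_prefix_count {R : realType} (n d : nat) (a s y : R)
    (l : seq expansion) : 0 < s ->
  uniq [seq mkseq b n | b <- l] ->
  (forall b, b \in l -> tilted_level_set d a s y b) ->
  (size l <= prefix_count n d a s y)%N.
Proof.
elim: n d a s l => [|n IH] d a s l s0 /=.
  case: l => [|b [|b' l]]//= _ yl.
  suff -> : a <= y <= a + s * tilt_max d by [].
  by apply/tilted_level_set_neq0 => //; exists b; apply: yl; rewrite mem_head.
move=> ul yl; have s20 : 0 < s / 2 by lra.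
have mkseqS b : mkseq b n.+1 = b 0%N :: mkseq (shift_expansion b) n.
  by rewrite /mkseq /= (iotaDl 1 0) -map_comp.
have uniq_shift c : uniq
    [seq mkseq b n | b <- [seq shift_expansion b | b <- l & b 0%N == c]].
  rewrite -map_comp -(map_inj_uniq (f := cons c)); last by move=> ? ? [].
  rewrite -map_comp; have /subseq_uniq : subseq
    [seq mkseq b n.+1 | b <- l & b 0%N == c] [seq mkseq b n.+1 | b <- l].
    exact/map_subseq/filter_subseq.
  move=> /(_ ul); congr uniq; apply/eq_in_map => b.
  by rewrite mem_filter mkseqS => /andP[/eqP-> _].
(* Solutions with the same first digit stay separated once it is removed. *)
rewrite -(count_predC (fun b : expansion => b 0%N == false)) -!size_filter.
apply: leq_add.
  rewrite -(size_map shift_expansion); apply: IH => //.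
  move=> b' /mapP[b + ->]; rewrite mem_filter => /andP[/eqP b0 /yl lb].
  exact: tilted_level_shift0.
rewrite (eq_filter (a2 := fun b : expansion => b 0%N == true)); last first.
  by move=> b /=; case: (b 0%N).
case: d yl => [|d] yl.
  rewrite leqn0 size_eq0; apply/eqP/eqP; rewrite -[_ == _]negbK -has_filter.
  apply/hasPn => b /yl [db _]; apply/negP => /eqP b0.
  by have [] := stays_above_shift1 _ _ b0 db.
rewrite -(size_map shift_expansion); apply: IH => //.
move=> b' /mapP[b + ->]; rewrite mem_filter => /andP[/eqP b0 /yl lb].
exact: tilted_level_shift1.
Qed.

Lemma leq_prefix_count {R : realType} (n d : nat) (a s y : R) : 0 < s ->
  (prefix_count n d a s y <= prefix_count n.+1 d a s y)%N.
Proof.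
elim: n d a s => [|n IH] d a s s0; last first.
  have s20 : 0 < s / 2 by lra.
  rewrite [leqLHS]/= [leqRHS]/=; apply: leq_add; first exact: IH.
  by case: d => // d; exact: IH.
have [|] := boolP (a <= y <= a + s * tilt_max d); last first.
  by move=> /negbTE yN; rewrite /prefix_count yN.
move=> /(tilted_level_set_neq0 _ _ _ _ s0)[b yb].
apply: (@leq_trans 1%N); first by rewrite /= leq_b1.
apply: (@size_le_prefix_count _ 1 d a s y [:: b]) => // b'.
by rewrite inE => /eqP ->.
Qed.

(** * Local level sets *)

Lemma block_positionsW (b : expansion) (c i j : nat) :
  (c <= i <= j)%N -> block_positions b c j -> block_positions b c i.
Proof.
move=> /andP[ci ij] [_ h]; split=> // c' Zc' cc'.
exact: leq_ltn_trans ij (h _ Zc' cc').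
Qed.

Lemma block_positions_cover (b : expansion) (j : nat) :
  exists2 c, balance_set b c & block_positions b c j.
Proof.
elim: j => [|j [c Zc [cj h]]].
  by exists 0%N; [exact: digit_excess0|split].
have [Zj|Zj] := eqVneq (digit_excess b j.+1) 0.
  by exists j.+1 => //; split.
exists c => //; split=> [|c' Zc' cc']; first exact: leqW.
rewrite ltn_neqAle h// andbT; apply/eqP => jc'.
by move: Zj; rewrite jc' Zc' eqxx.
Qed.

Lemma block_excess_neq0 (b : expansion) (c j : nat) :
  (c < j)%N -> block_positions b c j -> digit_excess b j != 0.
Proof. by move=> cj [_ h]; apply/eqP => Zj; have := h _ Zj cj; rewrite ltnn. Qed.

Lemma digit_excess_flip (b b' : expansion) (f : bool) (c m : nat) :
  balance_set b c -> balance_set b' c ->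
  (forall j, (c <= j < m)%N -> b' j = f (+) b j) ->
  (c <= m)%N -> digit_excess b' m = (if f then -1 else 1) * digit_excess b m.
Proof.
move=> Zc Z'c; elim: m => [|m IH] bb'.
  by rewrite leqn0 => /eqP c0; rewrite !digit_excess0 mulr0.
rewrite leq_eqVlt ltnS => /orP[/eqP <-|cm]; first by rewrite Zc Z'c mulr0.
rewrite !digit_excessS IH//; last first.
  by move=> j /andP[cj jm]; apply: bb'; rewrite cj ltnW.
rewrite bb' ?cm ?leqnn// /digit_step.
by case: f {bb' IH}; case: (b m) => /=; lia.
Qed.

(** Inside a block the excess is nonzero, so the absolute value of the next
    excess reveals whether the step moves away from 0 or towards it; the choice
    made by the first digit of the block then propagates to the whole block. *)
Lemma flip_of_abs_excess (b b' : expansion) (c j : nat) :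
  (forall j, `|digit_excess b j| = `|digit_excess b' j|) ->
  balance_set b c -> balance_set b' c ->
  block_positions b c j -> b' j = (b' c (+) b c) (+) b j.
Proof.
move=> bb' Zc Z'c bj; have [cj _] := bj.
rewrite -(subnKC cj); move: (j - c)%N (subnKC cj) => k ck.
elim/ltn_ind: k => k IH in j cj bj ck *.
case: k => [|k] in IH ck *; first by rewrite addn0 -addbA addbb addbF.
have flip i : (c <= i < j)%N -> b' i = (b' c (+) b c) (+) b i.
  move=> /andP[ci ij]; rewrite -(subnKC ci); apply: (IH _ _ i) => //.
  - by move: ck ij; rewrite -{1}(subnKC ci); lia.
  - by apply: block_positionsW bj; rewrite ci ltnW.
  - exact: subnKC.
have := digit_excess_flip _ _ _ _ _ Zc Z'c flip cj.
have cj' : (c < j)%N by lia.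
have := block_excess_neq0 _ _ _ cj' bj; have := bb' j.+1.
rewrite !digit_excessS ck /digit_step.
move: (b' c (+) b c) => f.
by case: f {flip}; case: (b j); case: (b' j); lia.
Qed.

(** Flipping a block reflects the path of the excess between two of its zeros,
    so a local level set is the set of all paths with a given absolute
    value. *)
Lemma equiv_expansionP (b b' : expansion) :
  equiv_expansion b b' <->
  forall j, `|digit_excess b j| = `|digit_excess b' j|.
Proof.
split=> [[ZZ' flips] j|bb'].
  have [c Zc bcj] := block_positions_cover b j; have [cj _] := bcj.
  have Z'c : balance_set b' c by rewrite -ZZ'.
  have block i : (c <= i < j)%N -> block_positions b c i.
    by move=> /andP[ci ij]; apply: block_positionsW bcj; rewrite ci ltnW.
  have [same|flip] := flips c Zc.
    rewrite (@digit_excess_flip b b' false c)//; first by rewrite mul1r.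
    by move=> i /block /same.
  rewrite (@digit_excess_flip b b' true c)//; first by rewrite mulN1r normrN.
  by move=> i /block /flip ->; rewrite addTb.
have ZZ' : balance_set b = balance_set b'.
  apply/seteqP; split=> j; rewrite /balance_set /= => /eqP.
    by rewrite -normr_eq0 bb' normr_eq0 => /eqP.
  by rewrite -normr_eq0 -bb' normr_eq0 => /eqP.
split=> // c Zc; have Z'c : balance_set b' c by rewrite -ZZ'.
case f: (b' c (+) b c); [right|left] => j bj.
  by rewrite (flip_of_abs_excess _ _ _ _ bb' Zc Z'c bj) f addTb.
by rewrite (flip_of_abs_excess _ _ _ _ bb' Zc Z'c bj) f addFb.
Qed.

Lemma digit_excess_inj (b b' : expansion) :
  digit_excess b =1 digit_excess b' -> b = b'.
Proof.
move=> bb'; apply/funext => j; have := bb' j.+1.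
rewrite !digit_excessS bb' /digit_step.
by case: (b j); case: (b' j); lia.
Qed.

(** The member of the local level set whose excess is the absolute value of the
    given one: its digit is 1 exactly where this absolute value decreases. *)
Definition straighten (b : expansion) : expansion :=
  fun j => `|digit_excess b j.+1| < `|digit_excess b j|.

Lemma digit_excess_straighten (b : expansion) (j : nat) :
  digit_excess (straighten b) j = `|digit_excess b j|.
Proof.
elim: j => [|j IH]; first by rewrite !digit_excess0.
rewrite digit_excessS IH /straighten !digit_excessS /digit_step.
by case: (b j); case: ifP; lia.
Qed.

Lemma straighten_stays_above (b : expansion) : stays_above 0 (straighten b).
Proof. by move=> j; rewrite add0r digit_excess_straighten. Qed.

Lemma local_level_set_straighten (b : expansion) :
  local_level_set (straighten b) = local_level_set b.
Proof.
by apply/seteqP; split=> b' /equiv_expansionP bb'; apply/equiv_expansionP => j;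
  rewrite -bb' digit_excess_straighten normr_id.
Qed.

Lemma local_level_set_inj (b b' : expansion) :
  stays_above 0 b -> stays_above 0 b' ->
  local_level_set b = local_level_set b' -> b = b'.
Proof.
move=> pb pb' e.
have /equiv_expansionP bb' : local_level_set b b'.
  by rewrite e; apply/equiv_expansionP.
apply: digit_excess_inj => j; have := bb' j.
by move: (pb j) (pb' j); rewrite !add0r => ? ?; rewrite !ger0_norm.
Qed.

Lemma takagi_equiv {R : realType} (b b' : expansion) : equiv_expansion b b' ->
  takagi (expansion_val R b) = takagi (expansion_val R b').
Proof.
move=> /equiv_expansionP bb'.
have : centered_takagi R 0 b = centered_takagi R 0 b'.
  by apply: centered_takagi_abs => j; rewrite !add0r.
by rewrite /centered_takagi /tilted_takagi !mul0r !subr0 !addr0.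
Qed.

Lemma local_level_sets_inE {R : realType} (y : R) :
  local_level_sets_in y = local_level_set @` tilted_level_set 0 0 1 y.
Proof.
have tiltE b : 0 + 1 * tilted_takagi R 0%N b = takagi (expansion_val R b).
  by rewrite add0r mul1r /tilted_takagi mul0r addr0.
apply/seteqP; split=> [A [[b ->] bA]|A [b [pb yb] <-]].
  exists (straighten b); last exact: local_level_set_straighten.
  split; first exact: straighten_stays_above.
  rewrite tiltE; apply: bA; rewrite -local_level_set_straighten.
  exact/equiv_expansionP.
split; first by exists b.
by move=> b' /takagi_equiv bb'; rewrite /level_set /= -bb' -tiltE.
Qed.

Lemma size_le_counting {T : choiceType} {R : realType} (A : set T) (l : seq T) :
  uniq l -> (forall x, x \in l -> A x) ->
  ((size l)%:R%:E <= counting A :> \bar R)%E.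
Proof.
move=> ul lA; rewrite /counting; case: ifPn => [/asboolP fA|_]; last exact: leey.
rewrite lee_fin ler_nat; apply: uniq_leq_size => // x /lA Ax.
by rewrite in_fset_set// inE.
Qed.

Lemma counting_le {T : choiceType} {R : realType} (A : set T) (z : \bar R) :
  (forall l : seq T, uniq l -> (forall x, x \in l -> A x) ->
    ((size l)%:R%:E <= z)%E) ->
  (counting A <= z)%E.
Proof.
move=> lz; rewrite /counting; case: ifPn => [/asboolP fA|/asboolP infA].
  by apply: lz => [|x]; [exact: finmap.fset_uniq|rewrite in_fset_set// inE].
rewrite leye_eq; apply/eqP/eqyP => r r0.
have [B BA nB] := infinite_set_fset (Num.trunc r).+1 infA.
apply: le_trans (lz _ (finmap.fset_uniq B) BA); rewrite lee_fin.
apply: (@le_trans _ _ (Num.trunc r).+1%:R); last by rewrite ler_nat.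
by rewrite ltW// truncnS_gt.
Qed.

(** Finitely many distinct expansions differ pairwise at finitely many
    positions, so all long prefixes tell them apart. *)
Lemma uniq_prefixes (l : seq expansion) : uniq l ->
  exists N, forall n, (N <= n)%N -> uniq [seq mkseq b n | b <- l].
Proof.
elim: l => [|b l IH] /=; first by exists 0%N.
move=> /andP[bl /IH[N ulN]].
suff [N' blN] : exists N', forall n, (N' <= n)%N ->
    mkseq b n \notin [seq mkseq b' n | b' <- l].
  by exists (maxn N N') => n; rewrite geq_max => /andP[/ulN -> /blN ->].
elim: l bl {IH ulN} => [|b' l IH]; first by exists 0%N.
rewrite inE negb_or => /andP[bb' /IH[N' blN]].
have [j bj] : exists j, b j != b' j.
  apply: contrapT => h; move/eqP: bb'; apply; apply/funext => j.
  by apply/eqP; apply: contrapT => /negP bj; apply: h; exists j.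
exists (maxn j.+1 N') => n; rewrite geq_max => /andP[jn /blN bln].
rewrite inE negb_or bln andbT; apply: contraNneq bj => e.
by rewrite -(nth_mkseq false b jn) e nth_mkseq.
Qed.

(** A uniform bound on the prefix counts bounds every finite family of
    solutions, so the limit is correct also when it is infinite. *)
Lemma Nloc_limn {R : realType} (y : R) :
  Nloc y = limn (fun n => (prefix_count n 0 0 1 y)%:R%:E : \bar R).
Proof.
have nd : nondecreasing_seq (fun n => (prefix_count n 0 0 1 y)%:R%:E : \bar R).
  by apply/nondecreasing_seqP => n; rewrite lee_fin ler_nat leq_prefix_count.
rewrite (cvg_lim _ (ereal_nondecreasing_cvgn nd))//.
rewrite /Nloc local_level_sets_inE; apply/eqP; rewrite eq_le; apply/andP; split.
  (* Each local level set in the list is traded for a representative. *)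
  have /choice[g gP] : forall A, exists b,
      (local_level_set @` tilted_level_set 0 0 1 y) A ->
      tilted_level_set 0 0 1 y b /\ local_level_set b = A.
    move=> A; have [[b yb <-]|nA] :=
      pselect ((local_level_set @` tilted_level_set 0 0 1 y) A).
      by exists b.
    by exists (fun=> false).
  apply: counting_le => l ul lA.
  have ugl : uniq [seq g A | A <- l].
    rewrite map_inj_in_uniq// => A B /lA/gP[_ gA] /lA/gP[_ gB] gAB.
    by rewrite -gA gAB.
  have [N /(_ N (leqnn N)) uN] := uniq_prefixes _ ugl.
  apply: ereal_sup_ge; exists (prefix_count N 0 0 1 y)%:R%:E; first by exists N.
  rewrite lee_fin ler_nat -(size_map g); apply: size_le_prefix_count => //.
  by move=> b /mapP[A /lA/gP[yA _] ->].
apply: ge_ereal_sup => _ [n _ <-].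
have [l [ul yl <-]] := @prefix_count_witnesses R n 0 0 1 y ltr01.
rewrite -(size_map local_level_set); apply: size_le_counting.
  rewrite map_inj_in_uniq// => b b' /yl[pb _] /yl[pb' _].
  exact: local_level_set_inj.
by move=> A /mapP[b /yl yb ->]; exists b.
Qed.

(** * Integration and the killed random walk *)

Lemma measurable_prefix_count {R : realType} (n d : nat) (a s : R) (D : set R) :
  measurable_fun D (fun y : R => (prefix_count n d a s y)%:R : R).
Proof.
elim: n d a s => [|n IH] d a s /=.
  have -> : (fun y => (nat_of_bool (a <= y <= a + s * tilt_max d))%:R) =
            \1_`[a, a + s * tilt_max d]%classic :> (R -> R).
    by apply/funext => y; rewrite indicE mem_setE in_itv.
  exact: measurable_indic.
under eq_fun do rewrite natrD.
apply: measurable_funD; first exact: IH.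
by case: d => [|d]; [exact: measurable_cst|exact: IH].
Qed.

(** The transition operator of the simple random walk on the nonnegative
    integers, killed when it steps from 0 to -1. *)
Definition killed_step {R : realType} (g : nat -> R) (d : nat) : R :=
  2^-1 * (g d.+1 + if d is d'.+1 then g d' else 0).

Lemma iter_killed_stepS {R : realType} (n : nat) (g : nat -> R) (d : nat) :
  iter n.+1 killed_step g d =
  2^-1 * (iter n killed_step g d.+1 +
          if d is d'.+1 then iter n killed_step g d' else 0).
Proof. by []. Qed.

(** Averaging over the next digit is one step of the walk. The set D contains
    the window of all attainable values, and the windows after one more digit
    lie in it, so no mass is lost. *)
Lemma integral_prefix_count {R : realType} (n d : nat) (a s : R) (D : set R) :
  measurable D -> 0 < s -> `[a, a + s * tilt_max d] `<=` D ->
  (\int[@lebesgue_measure R]_(y in D) (prefix_count n d a s y)%:R%:E =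
   (s * iter n killed_step tilt_max d)%:E)%E.
Proof.
move=> mD; elim: n d a s => [|n IH] d a s s0 aD.
  have -> : (fun y => (prefix_count 0 d a s y)%:R%:E) =
            (fun y => (\1_`[a, a + s * tilt_max d]%classic y)%:E) :> (R -> \bar R).
    by apply/funext => y; rewrite indicE mem_setE in_itv.
  rewrite integral_indic//= setIidl// lebesgue_measure_itv/= lte_fin.
  have M0 : 0 < tilt_max d :> R.
    apply: ltr_wpDl; first exact: ler0n.
    by rewrite mulr_gt0// invr_gt0 exprn_gt0.
  by rewrite ltrDl mulr_gt0// -EFinB addrAC subrr add0r.
have s20 : 0 < s / 2 by lra.
have sub0 : `[a, a + s / 2 * tilt_max d.+1] `<=` D.
  apply: subset_trans aD; apply: subset_itvl; rewrite bnd_simp lerD2l -mulrA.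
  by rewrite ler_pM2l//; have := @tilt_maxS_le R d; lra.
have mcount k a' s' :
    measurable_fun D (fun y : R => (prefix_count n k a' s' y)%:R%:E : \bar R).
  by apply/measurable_EFinP; exact: measurable_prefix_count.
rewrite iter_killed_stepS; case: d aD sub0 => [|d] aD sub0.
  under eq_integral do rewrite /= addn0.
  by rewrite IH// addr0 mulrA.
under eq_integral do rewrite /= natrD EFinD.
rewrite ge0_integralD//; [|exact: mcount..].
rewrite !IH//; first by rewrite -EFinD -mulrDr mulrA.
apply: subset_trans aD => y /=; rewrite !in_itv /= => /andP[ay ya].
apply/andP; split.
  by apply: le_trans _ ay; rewrite lerDl mulr_ge0 ?(ltW s0)// divr_ge0.
apply: (le_trans ya); rewrite -addrA lerD2l -mulrA -mulrDr ler_pM2l// tilt_maxS.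
lra.
Qed.

Definition survival {R : realType} (n d : nat) : R :=
  iter n killed_step (fun=> 1) d.

Lemma survival_ge0 {R : realType} (n d : nat) : 0 <= survival n d :> R.
Proof.
rewrite /survival; elim: n d => [|n IH] d//; rewrite iter_killed_stepS.
by rewrite mulr_ge0// addr_ge0//; case: d => // d; exact: IH.
Qed.

Lemma survival_nonincreasing {R : realType} (n d : nat) :
  survival n.+1 d <= survival n d :> R.
Proof.
rewrite /survival; elim: n d => [|n IH] d.
  by rewrite iter_killed_stepS; case: d => [|d] /=; lra.
rewrite iter_killed_stepS [leRHS]iter_killed_stepS ler_pM2l// lerD//.
by case: d.
Qed.

(** The limit p of the survival probabilities is harmonic for the killed walk,
    hence p d = (d + 1) p 0; as p is bounded by 1, it vanishes. *)
Lemma cvg_survival {R : realType} (d : nat) :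
  survival n d @[n --> \oo] --> (0 : R).
Proof.
have cvg_p k : cvgn (fun n => survival n k : R).
  apply: nonincreasing_is_cvgn.
    by apply/nonincreasing_seqP => n; exact: survival_nonincreasing.
  by exists 0 => _ [n _ <-]; exact: survival_ge0.
pose p k : R := limn (fun n => survival n k).
have p_harmonic k : p k = 2^-1 * (p k.+1 + if k is k'.+1 then p k' else 0).
  apply: cvg_lim => //; rewrite -(cvg_shiftS (fun n => survival n k)).
  apply: cvgM; first exact: cvg_cst.
  apply: cvgD; first exact: cvg_p.
  by case: k => [|k]; [exact: cvg_cst|exact: cvg_p].
have p_linear k : p k = k.+1%:R * p 0%N.
  suff : p k = k.+1%:R * p 0%N /\ p k.+1 = k.+2%:R * p 0%N by case.
  elim: k => [|k [pk pk1]]; first by have := p_harmonic 0%N; rewrite mul1r; lra.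
  split=> //; have := p_harmonic k.+1.
  rewrite pk1 pk -(natr1 k.+2) -(natr1 k.+1); lra.
have p_le1 k : p k <= 1.
  apply: limr_le => //; apply: nearW => n.
  elim: n => [|n IH]; first by [].
  exact: le_trans (survival_nonincreasing n k) IH.
have p00 : p 0%N = 0.
  apply/eqP; rewrite eq_le; apply/andP; split; last first.
    by apply: limr_ge => //; apply: nearW => n; exact: survival_ge0.
  rewrite leNgt; apply/negP => p0.
  have := p_le1 (Num.trunc (p 0%N)^-1); rewrite p_linear leNgt => /negP; apply.
  by rewrite -ltr_pdivrMr// div1r truncnS_gt.
have <- : p d = 0 by rewrite p_linear p00 mulr0.
exact: cvg_p.
Qed.

(** The function d + 1 is fixed by the killed walk, and M_d differs from it by
    at most 1, so after n steps the difference is at most the survival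
    probability. *)
Lemma iter_killed_tilt_max {R : realType} (n d : nat) :
  d.+1%:R - survival n d <= (iter n killed_step tilt_max d : R) <= d.+1%:R.
Proof.
rewrite /survival; elim: n d => [|n IH] d.
  by have := @tilt_max_ge R d; have := @tilt_max_le R d; rewrite -(natr1 d) /=; lra.
rewrite !iter_killed_stepS; have := IH d.+1.
case: d => [|d]; last by have := IH d; rewrite -(natr1 d.+2) -(natr1 d.+1); lra.
lra.
Qed.

Lemma cvg_iter_killed_tilt_max {R : realType} (d : nat) :
  iter n killed_step tilt_max d @[n --> \oo] --> (d.+1%:R : R).
Proof.
apply: (@squeeze_cvgr _ _ _ _ (fun n => d.+1%:R - survival n d) (fun=> d.+1%:R)).
- by apply: nearW => n; exact: iter_killed_tilt_max.
- rewrite -[X in _ --> X]subr0; apply: cvgB; first exact: cvg_cst.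
  exact: cvg_survival.
- exact: cvg_cst.
Qed.

Lemma cvg_prefix_count {R : realType} (y : R) :
  (prefix_count n 0 0 1 y)%:R%:E @[n --> \oo] --> (Nloc y : \bar R).
Proof.
rewrite Nloc_limn; apply: ereal_nondecreasing_is_cvgn.
by apply/nondecreasing_seqP => n; rewrite lee_fin ler_nat leq_prefix_count.
Qed.

Lemma measurable_Nloc {R : realType} (D : set R) :
  measurable D -> measurable_fun D (Nloc : R -> \bar R).
Proof.
move=> mD.
apply: (emeasurable_fun_cvg
  (fun n (y : R) => (prefix_count n 0 0 1 y)%:R%:E : \bar R)) => [n|y _].
  by apply/measurable_EFinP; exact: measurable_prefix_count.
exact: cvg_prefix_count.
Qed.

Lemma Nloc_ge0 {R : realType} (y : R) : (0 <= Nloc y)%E.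
Proof. by rewrite /Nloc /counting; case: ifP => _; rewrite ?lee_fin ?leey. Qed.

Lemma integral_Nloc {R : realType} :
  (\int[@lebesgue_measure R]_(y in `[0%R, (2 / 3)%R]) Nloc y = 1)%E.
Proof.
have M0 : `[0, 0 + 1 * tilt_max 0] `<=` (`[0, 2 / 3] : set R).
  by rewrite add0r mul1r /tilt_max add0r expr0 invr1 mulr1.
transitivity (limn (fun n => \int[@lebesgue_measure R]_(y in `[0%R, (2 / 3)%R])
    (prefix_count n 0 0 1 y)%:R%:E)%E).
  rewrite -monotone_convergence//.
  - by apply: eq_integral => y _; exact: Nloc_limn.
  - by move=> n; apply/measurable_EFinP; exact: measurable_prefix_count.
  - move=> y _; apply/nondecreasing_seqP => n.
    by rewrite lee_fin ler_nat leq_prefix_count.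
under eq_fun do rewrite integral_prefix_count// mul1r.
apply: cvg_lim => //; apply: cvg_EFin; first exact: nearW.
exact: cvg_iter_killed_tilt_max.
Qed.

Theorem theorem1p6 (R : realType) :
  [/\ measurable_fun (`[0, 2 / 3] : set R) (Nloc : R -> \bar R),
      {ae (@lebesgue_measure R), forall y : R,
         y \in `[0, 2 / 3] -> Nloc y \is a fin_num} &
      ((3 / 2)%:E * \int[@lebesgue_measure R]_(y in `[0%R, (2 / 3)%R]) Nloc y
         = (3 / 2)%:E)%E].
Proof.
have int_Nloc : (@lebesgue_measure R).-integrable `[0, 2 / 3] (@Nloc R).
  apply/integrableP; split; first exact: measurable_Nloc.
  under eq_integral do rewrite gee0_abs ?Nloc_ge0//.
  by rewrite integral_Nloc ltry.
split; first exact: measurable_Nloc.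
- have mI : measurable (`[0, 2 / 3] : set (measurableTypeR R)) by [].
  by apply: filterS (integrable_ae mI int_Nloc) => y; apply.
- by rewrite integral_Nloc mule1.
Qed.
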